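(* Let $n \ge 2$ and let $P$ be an instance of the stable matching problem with $n$ men and $n$ women. Let $p_A$ be the total number of proposals made when running the man-proposing accelerated deferred acceptance (ADA) algorithm on $P$, and let $p_D$ be the total number of proposals made when running the man-proposing deferred acceptance (DA) algorithm on $P$. Then $p_A \le p_D$.
   Context: Instance. $M$ is a set of $n$ men and $W$ is a set of $n$ women, $n \ge 2$. An instance $P$ of the stable matching problem consists of, for each man $m \in M$, a strict preference relation (strict linear order) $\succ_m$ on all of $W$, and, for each woman $w \in W$, a strict preference relation (strict linear order) $\succ_w$ on all of $M$. The two (man-proposing) algorithms. Both proceed in rounds $1, 2, 3, \dots$. Initially all men are single, no woman has rejected any man, and no one is matched. Each round has three steps: 1. Each man who is single at the start of the round proposes to his most preferred woman among those who have not yet rejected him. 2. Each woman $w$ who holds at least one proposal tentatively accepts her most preferred proposer $m^*$ (with respect to $\succ_w$). Here the proposers of $w$ in a round are the men who propose to her in that round together with the man, if any, with whom she was tentatively matched at the end of the previous round. Then: - in DA, $w$ rejects all of her proposers that she ranks below $m^*$; - in ADA, $w$ rejects all men in $M$ that she ranks below $m^*$, whether or not they have proposed to her. Rejections are permanent. 3. The man accepted by $w$ is tentatively matched with $w$; every man who is not tentatively matched at the end of the round is single for the next round. The algorithm terminates at the end of the first round after which no man is single, and it returns the current set of tentatively matched pairs. The total number of proposals of a run is the number of proposals made in step 1, summed over all rounds until termination (a man who remains tentatively matched from a previous round makes no new proposal). *)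

(* Defs.v *)
From mathcomp Require Import all_boot.

Set Implicit Arguments.
Unset Strict Implicit.
Unset Printing Implicit Defensive.

Definition strict_linear_order (T : eqType) (r : rel T) : Prop :=
  [/\ irreflexive r, transitive r & forall x y, x != y -> r x y || r y x].

(* [mpref P m w w'] (resp. [wpref P w m m']) means that [m] strictly prefers
   [w] to [w'] (resp. that [w] strictly prefers [m] to [m']). *)
Record sm_instance (n : nat) (M W : finType) := SMInstance {
  mpref : M -> rel W;
  wpref : W -> rel M;
  mpref_linear : forall m, strict_linear_order (mpref m);
  wpref_linear : forall w, strict_linear_order (wpref w);
  card_men : #|M| = n;
  card_women : #|W| = n
}.

Definition most_preferred (T : finType) (r : rel T) (A : {set T}) : option T :=
  [pick x in A | [forall y in A, (y != x) ==> r x y]].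

Lemma most_preferredP (T : finType) (r : rel T) (A : {set T}) x :
  most_preferred r A = Some x ->
  x \in A /\ forall y, y \in A -> y != x -> r x y.
Proof.
rewrite /most_preferred; case: pickP => // z /andP[zA /forallP h] [<-].
by split=> // y yA yz; have := h y; rewrite yA yz.
Qed.

Lemma most_preferred_ex (T : finType) (r : rel T) (A : {set T}) x0 :
  strict_linear_order r -> x0 \in A -> exists x, most_preferred r A = Some x.
Proof.
case=> irr tr tot x0A.
case: (@arg_minnP _ x0 (mem A) (fun x => #|[set y in A | r y x]|) x0A) => x xA xmin.
rewrite /most_preferred; case: pickP => [z _|/(_ x)]; first by exists z.
have {}xA : x \in A by [].
rewrite xA /= => /negbT/forallPn[y]; rewrite !negb_imply => /and3P[yA yx nxy].
have ryx : r y x by have := tot _ _ yx; rewrite (negbTE nxy) orbF.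
have := xmin y yA; rewrite leqNgt => /negP[]; apply/proper_card/properP; split.
  by apply/subsetP=> z; rewrite !inE => /andP[-> /tr]; apply.
by exists y; rewrite !inE yA ?ryx ?irr.
Qed.

Inductive algorithm := DA | ADA.

(* [(m, w) \in rejected s]: [w] has rejected [m];
   [(m, w) \in matching s]: [m] and [w] are tentatively matched. *)
Record state (M W : finType) := State {
  rejected : {set M * W};
  matching : {set M * W}
}.

Definition initial_state (M W : finType) : state M W := State set0 set0.

Definition single (M W : finType) (s : state M W) (m : M) : bool :=
  [forall w, (m, w) \notin matching s].

Section Run.
Context (n : nat) (M W : finType) (P : sm_instance n M W).
Implicit Types (s : state M W) (a : algorithm).

(* The proposals made in the round that starts in state [s]. *)
Definition proposals s : {set M * W} :=
  [set p | single s p.1 &&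
    (most_preferred (mpref P p.1) [set w | (p.1, w) \notin rejected s]
       == Some p.2)].

Definition proposers s (w : W) : {set M} :=
  [set m | ((m, w) \in proposals s) || ((m, w) \in matching s)].

Definition accepted s (w : W) : option M :=
  most_preferred (wpref P w) (proposers s w).

Definition new_rejections a s : {set M * W} :=
  [set p | if accepted s p.2 is Some mstar then
             wpref P p.2 mstar p.1 &&
             (if a is DA then p.1 \in proposers s p.2 else true)
           else false].

Definition round a s : state M W :=
  State (rejected s :|: new_rejections a s)
        [set p | accepted s p.2 == Some p.1].

Definition state_after a (k : nat) : state M W :=
  iter k (round a) (initial_state M W).

Definition no_man_single s : bool := [forall m, ~~ single s m].

Let invariant s : Prop :=
  [/\ forall m w, (m, w) \in rejected s -> exists m', (m', w) \in matching s,
      forall m w w', (m, w) \in matching s -> (m, w') \in matching s -> w = w'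
    & forall m w, (m, w) \in matching s -> (m, w) \notin rejected s].

Let proposers_notin_rejected s m w :
  invariant s -> m \in proposers s w -> (m, w) \notin rejected s.
Proof.
case=> _ _ i3; rewrite !inE /= => /orP[/andP[_ /eqP/most_preferredP[]]|/i3 //].
by rewrite inE.
Qed.

Let accepted_ex s m w : m \in proposers s w -> exists m', accepted s w = Some m'.
Proof. exact: most_preferred_ex (wpref_linear P w). Qed.

Let invariant_round a s : invariant s -> invariant (round a s).
Proof.
move=> inv; case: (inv) => i1 i2 i3; split=> /=.
- move=> m w; rewrite !inE /= => /orP[/i1[m' m'w]|].
    have [|m2 e] := @accepted_ex s m' w; first by rewrite inE m'w orbT.
    by exists m2; rewrite inE /= e.
  by case e: (accepted s w) => [m2|] // _; exists m2; rewrite inE /= e.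
- move=> m w w'; rewrite !inE /= => /eqP/most_preferredP[+ _].
  move=> + /eqP/most_preferredP[+ _].
  rewrite !inE /= => /orP[/andP[sm /eqP e]|mw] /orP[/andP[sm' /eqP e']|mw'].
  + by move: e; rewrite e' => -[].
  + by move/forallP: sm => /(_ w'); rewrite mw'.
  + by move/forallP: sm' => /(_ w); rewrite mw.
  + exact: i2 mw mw'.
- move=> m w; rewrite !inE /= => /eqP e; rewrite e.
  have [irr _ _] := wpref_linear P w.
  rewrite irr andFb orbF; apply: proposers_notin_rejected => //.
  by have [] := most_preferredP e.
Qed.

Let invariant_after a k : invariant (state_after a k).
Proof.
elim: k => [|k IH]; last exact: invariant_round.
by split=> [m w|m w w'|m w]; rewrite !inE.
Qed.

Let single_not_rejected s m :
  invariant s -> single s m -> exists w, (m, w) \notin rejected s.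
Proof.
case=> i1 i2 _ /forallP sm; apply/existsP; rewrite -negb_forall.
apply/negP => /forallP rej.
have held w : exists m', (m', w) \in matching s by apply: i1 (rej w).
have injf : injective (fun w => xchoose (held w)).
  move=> w w' e; have h := xchooseP (held w); have h' := xchooseP (held w').
  by move: h'; rewrite -e; apply: i2.
have : m \in codom (fun w => xchoose (held w)).
  by apply: inj_card_onto => //; rewrite (card_men P) (card_women P).
by case/codomP=> w e; have := sm w; rewrite e (xchooseP (held w)).
Qed.

Let rejected_grows a s :
  invariant s -> ~~ no_man_single (round a s) ->
  #|rejected s| < #|rejected (round a s)|.
Proof.
move=> inv /forallPn[m]; rewrite negbK => /forallP sm'.
have [w mw] : exists w, m \in proposers s w.
  case sm: (single s m); last first.
    have /forallPn[w] := negbT sm; rewrite negbK => mw.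
    by exists w; rewrite inE mw orbT.
  have [w0 mw0] := single_not_rejected inv sm.
  have [|w e] := @most_preferred_ex _ (mpref P m)
    [set w | (m, w) \notin rejected s] w0 (mpref_linear P m).
    by rewrite inE.
  by exists w; rewrite !inE /= sm e eqxx.
have [m' e] := accepted_ex mw.
have neq : m != m'.
  by apply/eqP=> em; have := sm' w; rewrite inE /= e em eqxx.
have r' : wpref P w m' m by have [_] := most_preferredP e; apply.
apply/proper_card/properP; split; first exact: subsetUl.
exists (m, w); last exact: proposers_notin_rejected.
by rewrite inE [X in _ || X]inE /= e r' mw; case: (a); rewrite orbT.
Qed.

Lemma termination a : exists k, (0 < k) && no_man_single (state_after a k).
Proof.
case: (boolP [exists k : 'I_(#|{: M * W}|.+1),
                no_man_single (state_after a k.+1)]) => [/existsP[k]|].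
  by exists k.+1.
move/existsPn=> h.
have grow k : k <= #|{: M * W}|.+1 -> k <= #|rejected (state_after a k)|.
  elim: k => // k IH lk; apply: leq_ltn_trans (IH (ltnW lk)) _.
  by apply: rejected_grows; [exact: invariant_after|exact: h (Ordinal lk)].
have := leq_trans (grow _ (leqnn _)) (max_card _).
by rewrite ltnn.
Qed.

(* The first round after which no man is single. *)
Definition num_rounds a : nat := ex_minn (termination a).

Definition num_proposals a : nat :=
  \sum_(k < num_rounds a) #|proposals (state_after a k)|.

End Run.

(* Main.v *)
(* Call a pair settled once it is matched or rejected.  In DA the number of
   proposals bounds the number of settled pairs; in both algorithms a proposed
   pair is newly settled, so no pair is proposed twice.  Let mu be the outcome
   of DA.  It is stable, hence ADA never rejects a pair of mu: for the first
   such rejection, of (m, w) in favour of m', all women that m' prefers to w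
   have rejected him, mu(m') is not among them, and (m', w) blocks mu.  So in
   ADA each man m only proposes to women that he weakly prefers to mu(m), and
   all these pairs are settled at the end of DA. *)

Require Import Defs.
From mathcomp Require Import all_boot.

Set Implicit Arguments.
Unset Strict Implicit.
Unset Printing Implicit Defensive.

Lemma strict_linear_asym (T : eqType) (r : rel T) x y :
  strict_linear_order r -> r x y -> r y x -> False.
Proof. by case=> irr tr _ xy yx; have := tr _ _ _ xy yx; rewrite irr. Qed.

Section Rounds.
Context (n : nat) (M W : finType) (P : sm_instance n M W).
Implicit Types (s t : state M W) (a : algorithm).

Definition settled s : {set M * W} := rejected s :|: matching s.

(** This invariant carries stability: a man who prefers [w'] to his partner was rejected by [w'],
    and a woman who has rejected a man holds a better one. So no pair blocks once no man is
    single. *)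
Definition coherent s : Prop :=
  [/\ forall m w w', (m, w) \in matching s -> mpref P m w' w ->
        (m, w') \in rejected s,
      forall m w, (m, w) \in rejected s ->
        exists2 m', (m', w) \in matching s & wpref P w m' m
    & forall m m' w, (m, w) \in matching s -> (m', w) \in matching s -> m = m'].

Lemma proposal_best s m w w' :
  (m, w) \in proposals P s -> (m, w') \notin rejected s -> w' != w ->
  mpref P m w w'.
Proof.
rewrite inE => /andP[_ /eqP/most_preferredP[_ best]] nrej ne.
by apply: best; rewrite ?inE.
Qed.

Lemma proposals_settled_disjoint s : [disjoint proposals P s & settled s].
Proof.
rewrite disjoint_subset; apply/subsetP=> -[m w].
rewrite !inE /= => /andP[/forallP/(_ w)/negbTE-> /eqP/most_preferredP[+ _]].
by rewrite inE orbF.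
Qed.

(** A new proposer chooses his best woman among those who have not rejected him; for a man already
    held, this is the first clause of [coherent]. *)
Lemma proposer_above_rejected s m w w' :
  coherent s -> m \in proposers P s w -> mpref P m w' w ->
  (m, w') \in rejected s.
Proof.
case=> above _ _; rewrite inE => /orP[prop|mw] ww'; last exact: above mw ww'.
apply: contraT => nrej; case: (@strict_linear_asym _ _ w' w (mpref_linear P m)) => //.
apply: proposal_best prop nrej _; apply: contraTneq ww' => ->.
by have [-> _ _] := mpref_linear P m.
Qed.

Lemma accepted_ge s m w : m \in proposers P s w ->
  exists2 m', accepted P s w = Some m' & (m' == m) || wpref P w m' m.
Proof.
move=> mw; have [m' e] := most_preferred_ex (wpref_linear P w) mw.
exists m' => //; have [_ best] := most_preferredP e.
by case: (eqVneq m' m) => //= ne; apply: best => //; rewrite eq_sym.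
Qed.

Lemma proposers_settled_round a s m w :
  m \in proposers P s w -> (m, w) \in settled (round P a s).
Proof.
move=> mw; have [m' e le] := accepted_ge mw.
case/orP: le => [/eqP em|lt]; first by rewrite !inE /= e em eqxx orbT.
by rewrite inE [in X in X || _]inE [X in _ || X || _]inE /= e lt mw; case: (a);
  rewrite orbT.
Qed.

Lemma settled_round a s :
  proposals P s :|: settled s \subset settled (round P a s).
Proof.
apply/subsetP=> -[m w] /setUP[prop|/setUP[rej|mw]].
- by apply: proposers_settled_round; rewrite inE prop.
- by rewrite !in_setU rej.
- by apply: proposers_settled_round; rewrite inE mw orbT.
Qed.

(** Specific to DA, where only proposers are rejected; ADA may also settle pairs that were never
    proposed. *)
Lemma settled_round_DA s :
  settled (round P DA s) \subset proposals P s :|: settled s.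
Proof.
have prop m w : m \in proposers P s w -> (m, w) \in proposals P s :|: settled s.
  by rewrite inE !in_setU => /orP[->|->] //; rewrite !orbT.
apply/subsetP=> -[m w]; rewrite [in X in X -> _]inE => /orP[/setUP[rej|]|].
- by rewrite !in_setU rej orbT.
- by rewrite inE /=; case: (accepted P s w) => // m' /andP[_ /prop].
- by rewrite inE /= => /eqP/most_preferredP[/prop].
Qed.

Lemma coherent_round a s : coherent s -> coherent (round P a s).
Proof.
move=> coh; have [_ worse _] := coh; split=> /=.
- move=> m w w'; rewrite inE /= => /eqP/most_preferredP[mw _] ww'.
  by rewrite in_setU (proposer_above_rejected coh mw ww').
- move=> m w; rewrite inE => /orP[/worse[m1 m1w lt]|]; last first.
    rewrite inE /=; case e: (accepted P s w) => [m'|] // /andP[lt _].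
    by exists m'; rewrite // inE /= e.
  (* The man [m1] held so far is again among the proposers, so [w] can only trade up and her old
     rejections stay justified. *)
  have [|m' e le] := @accepted_ge s m1 w; first by rewrite inE m1w orbT.
  exists m'; first by rewrite inE /= e.
  case/orP: le => [/eqP->//|lt'].
  by have [_ tr _] := wpref_linear P w; apply: tr lt' lt.
- by move=> m m' w; rewrite !inE /= => /eqP-> /eqP[].
Qed.

Lemma coherent_after a k : coherent (state_after P a k).
Proof.
elim: k => [|k IH]; last exact: coherent_round.
by split=> [m w w'|m w|m m' w]; rewrite !inE.
Qed.

Lemma settled_DA_le k :
  #|settled (state_after P DA k)| <= \sum_(j < k) #|proposals P (state_after P DA j)|.
Proof.
elim: k => [|k IH]; first by rewrite big_ord0 /settled /= setU0 cards0.
rewrite big_ord_recr /= addnC.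
apply: leq_trans (subset_leq_card (settled_round_DA _)) _.
by apply: leq_trans (leq_card_setU _ _) _; rewrite leq_add2l.
Qed.

Lemma sum_proposals_le_card a k (S : {set M * W}) :
  (forall j, proposals P (state_after P a j) \subset S) ->
  \sum_(j < k) #|proposals P (state_after P a j)| <= #|S|.
Proof.
move=> sub; set s := state_after P a in sub *.
(* Strengthened for the induction: the proposals of a round avoid [settled (s k)] and lie in
   [settled (s k.+1)], so each one adds a new element to the intersection. *)
suff h : \sum_(j < k) #|proposals P (s j)| <= #|settled (s k) :&: S|.
  by apply: leq_trans h (subset_leq_card (subsetIr _ _)).
elim: k => [|k IH]; first by rewrite big_ord0.
rewrite big_ord_recr /= addnC; apply: leq_trans (leq_add (leqnn _) IH) _.
have dis : proposals P (s k) :&: (settled (s k) :&: S) = set0.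
  by rewrite setIA (disjoint_setI0 (proposals_settled_disjoint _)) set0I.
have /subUsetP[sub1 sub2] := settled_round a (s k).
rewrite -cardsUI dis cards0 addn0 subset_leq_card //.
by rewrite subUset !subsetI sub1 sub subsetIr andbT (subset_trans (subsetIl _ _)).
Qed.

Section Outcome.
(** DA enters only through these two hypotheses on its final state: they make [matching t] perfect
    and stable. *)
Variables (t : state M W).
Hypotheses (coh_t : coherent t) (final_t : no_man_single t).

Lemma outcome_ex m : exists w, (m, w) \in matching t.
Proof.
by have /forallP/(_ m)/forallPn[w] := final_t; rewrite negbK => mw; exists w.
Qed.

Lemma ADA_keeps_outcome k m w :
  (m, w) \in matching t -> (m, w) \notin rejected (state_after P ADA k).
Proof.
have [above worse uniq_m] := coh_t.
elim: k m w => [|k IH] m w mw; first by rewrite inE.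
set s := state_after P ADA k in IH *.
rewrite in_setU (negbTE (IH _ _ mw)) inE /=.
case e: (accepted P s w) => [m'|] //; rewrite andbT; apply/negP=> lt.
have [m'w _] := most_preferredP e.
have [w' m'w'] := outcome_ex m'.
have ne : w != w'.
  apply: contraTneq lt => ww'; rewrite -ww' in m'w'.
  by rewrite (uniq_m _ _ _ m'w' mw); have [-> _ _] := wpref_linear P w.
have better : mpref P m' w w'.
  have [_ _ tot] := mpref_linear P m'.
  (* If [m'] preferred [w'], then [w'] would already have rejected him in ADA, against the induction
     hypothesis. *)
  case/orP: (tot _ _ ne) => // w'w; have := IH _ _ m'w'.
  by rewrite (proposer_above_rejected (coherent_after _ _) m'w w'w).
(* In [t], [w] has rejected [m'] for the man she holds. That man is [m], whom she ranks below
   [m']. *)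
have [m1 m1w lt1] := worse _ _ (above _ _ _ m'w' better).
rewrite (uniq_m _ _ _ m1w mw) in lt1.
exact: strict_linear_asym (wpref_linear P w) lt lt1.
Qed.

Lemma ADA_proposals_settled k :
  proposals P (state_after P ADA k) \subset settled t.
Proof.
have [above _ _] := coh_t.
apply/subsetP=> -[m w] prop; have [w' mw'] := outcome_ex m.
rewrite in_setU; case: (eqVneq w' w) => [<-|ne]; first by rewrite mw' orbT.
by rewrite (above _ _ _ mw') // (proposal_best prop) ?ADA_keeps_outcome.
Qed.

End Outcome.

End Rounds.

Theorem theorem3 (n : nat) (M W : finType) (P : sm_instance n M W) :
  2 <= n -> num_proposals P ADA <= num_proposals P DA.
Proof.
move=> _; have final : no_man_single (state_after P DA (num_rounds P DA)).
  by rewrite /num_rounds; case: ex_minnP => k /andP[].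
(* The middle term is the number of pairs settled at the end of DA; it bounds the ADA proposals over
   any number of rounds. *)
apply: leq_trans (settled_DA_le P _); apply: sum_proposals_le_card => j.
exact: ADA_proposals_settled (coherent_after _ _ _) final _.
Qed.
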